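(* There exists an absolute constant $C>0$ such that the following holds. Let $R$ be a ring, and let $A \subset R^*$ be a finite non-empty set of non-zero-divisors such that $|A+A| \leq K|A|$ and $|A \cdot A| \leq K|A|$ for some $K \geq 1$. Then one of the following holds: (i) ($A-A$ has many zero divisors) $|(A-A) \setminus R^*| \geq C^{-1} K^{-C} |A|$; (ii) (Existence of good subset) there exists a subset $A'$ of $A$ such that $|A'| \geq |A|/(2K)$ and $|A' \cdot A' - A' \cdot A'| = O(K^{O(1)} |A'|)$.
   Context: Rings are associative, but need not be commutative and need not contain a multiplicative identity. For subsets $A,B$ of a ring $R$: $A+B := \{a+b : a\in A, b\in B\}$, $A-B := \{a-b : a \in A, b\in B\}$, $A\cdot B := \{ab : a\in A, b\in B\}$. $|A|$ denotes the cardinality of a finite set $A$. $R^*$ denotes the set of non-zero-divisors of $R$, i.e. the elements $r \in R$ such that $ra \neq 0$ and $ar \neq 0$ whenever $a \in R$, $a \neq 0$. The notation $X = O(K^{O(1)} Y)$ means $X \leq C_1 K^{C_2} Y$ for some absolute constants $C_1, C_2 > 0$. *)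

(* Defs.v *)
From HB Require Import structures.
From mathcomp Require Import all_boot all_order all_algebra finmap.
From mathcomp Require Import boolp classical_sets reals exp.

Set Implicit Arguments.
Unset Strict Implicit.
Unset Printing Implicit Defensive.

Import Order.TTheory GRing.Theory Num.Theory.

Local Open Scope ring_scope.

(* The ring structures of ssralg are all unital, so an associative ring that
   need not be commutative nor unital is built here from an abelian group
   (written additively) and a semigroup (whose product is [*%g]). *)
HB.mixin Record isBiadditive R of GRing.Zmodule R & Semigroup R := {
  rngMDl : forall x y z : R, ((x + y) * z)%g = (x * z)%g + (y * z)%g :> R;
  rngMDr : forall x y z : R, (x * (y + z))%g = (x * y)%g + (x * z)%g :> R
}.

#[short(type="rngType")]
HB.structure Definition Rng :=
  { R of GRing.Zmodule R & Semigroup R & isBiadditive R }.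

Definition nonzerodivisors (R : rngType) : set R :=
  [set r | forall a : R, a != 0 -> (r * a)%g != 0 /\ (a * r)%g != 0].
Arguments nonzerodivisors R : clear implicits.

Definition sumset (R : rngType) (A B : {fset R}) : {fset R} :=
  [fset (a + b)%R | a in A, b in B]%fset.

Definition diffset (R : rngType) (A B : {fset R}) : {fset R} :=
  [fset (a - b)%R | a in A, b in B]%fset.

Definition prodset (R : rngType) (A B : {fset R}) : {fset R} :=
  [fset (a * b)%g | a in A, b in B]%fset.

(* Main.v *)
(* By Cauchy-Schwarz some b in A has at least |A|^2/K triples (u, a, c) in A with
   b u = a c.  Summing over a, the set A' of all a for which a A meets b A in at
   least |A|/2K points has at least |A|/2K elements; summing over c instead, some
   A c meets b A in at least |A|/K points.  This second fact replaces
   commutativity.  Write D_0 = A and D_(n+1) = D_n - D_n.  Ruzsa covering puts a A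
   in boundedly many translates of b D_1 for a in A', and b A in boundedly many
   translates of D_1 c, so that up to boundedly many translates
     a1 a2 A <= a1 b D_1 <= a1 D_2 c <= b D_3 c,
   and x A <= b D_4 c for every x in A'A' - A'A'.  By pigeonhole, x d lies in
   b D_5 c for a proportion K^-O(1) of all d in A - A.  Unless (i) holds, most of
   these d are non-zero-divisors, and then (d, x d) determines x; there are at most
   |D_1| |D_5| = O(K^O(1) |A|^2) such pairs, by Petridis' proof of Pluennecke's
   inequality. *)

Require Import Defs.
From mathcomp Require Import all_boot all_order all_algebra finmap.
From mathcomp Require Import boolp classical_sets reals exp.
From mathcomp Require Import ring lra zify.

Import Order.TTheory GRing.Theory Num.Theory.

Local Open Scope ring_scope.

Implicit Types (F : realType) (R : rngType).

(** * Sum, difference and product sets of finite sets *)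

Lemma sumsetP {R} {A B : {fset R}} {x : R} :
  reflect (exists a b, [/\ a \in A, b \in B & x = a + b]) (x \in sumset A B).
Proof.
apply: (iffP (imfset2P _ _ _ _ _)) => [[a aA [b bB ->]]|[a [b [aA bB ->]]]].
  by exists a, b.
by exists a => //; exists b.
Qed.

Lemma diffsetP {R} {A B : {fset R}} {x : R} :
  reflect (exists a b, [/\ a \in A, b \in B & x = a - b]) (x \in diffset A B).
Proof.
apply: (iffP (imfset2P _ _ _ _ _)) => [[a aA [b bB ->]]|[a [b [aA bB ->]]]].
  by exists a, b.
by exists a => //; exists b.
Qed.

Lemma prodsetP {R} {A B : {fset R}} {x : R} :
  reflect (exists a b, [/\ a \in A, b \in B & x = (a * b)%g])
          (x \in prodset A B).
Proof.
apply: (iffP (imfset2P _ _ _ _ _)) => [[a aA [b bB ->]]|[a [b [aA bB ->]]]].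
  by exists a, b.
by exists a => //; exists b.
Qed.

Lemma mem_sumset {R} {A B : {fset R}} {a b : R} :
  a \in A -> b \in B -> a + b \in sumset A B.
Proof. by move=> aA bB; apply/sumsetP; exists a, b. Qed.

Lemma mem_diffset {R} {A B : {fset R}} {a b : R} :
  a \in A -> b \in B -> a - b \in diffset A B.
Proof. by move=> aA bB; apply/diffsetP; exists a, b. Qed.

Lemma sumsetA {R} (A B C : {fset R}) :
  sumset A (sumset B C) = sumset (sumset A B) C.
Proof.
apply/fsetP=> x; apply/sumsetP/sumsetP.
  case=> a [_ [aA /sumsetP[b [c [bB cC ->]]] ->]].
  by exists (a + b), c; rewrite addrA mem_sumset.
case=> _ [c [/sumsetP[a [b [aA bB ->]]] cC ->]].
by exists a, (b + c); rewrite addrA mem_sumset.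
Qed.

Lemma sumsetS {R} (A B C D : {fset R}) :
  (A `<=` C)%fset -> (B `<=` D)%fset -> (sumset A B `<=` sumset C D)%fset.
Proof.
move=> /fsubsetP AC /fsubsetP BD; apply/fsubsetP=> _ /sumsetP[a [b [aA bB ->]]].
by rewrite mem_sumset ?AC ?BD.
Qed.

Lemma diffsetS {R} (A B C D : {fset R}) :
  (A `<=` C)%fset -> (B `<=` D)%fset -> (diffset A B `<=` diffset C D)%fset.
Proof.
move=> /fsubsetP AC /fsubsetP BD; apply/fsubsetP=> _ /diffsetP[a [b [aA bB ->]]].
by rewrite mem_diffset ?AC ?BD.
Qed.

Lemma sumset0 {R} (A : {fset R}) : sumset A [fset 0]%fset = A.
Proof.
apply/fsetP=> x; apply/sumsetP/idP => [[a [b [aA]]]|xA].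
  by rewrite inE => /eqP -> ->; rewrite addr0.
by exists x, 0; rewrite addr0 inE.
Qed.

Lemma sumset_empty {R} (A : {fset R}) : sumset A fset0 = fset0.
Proof.
apply/fsetP=> x; rewrite in_fset0; apply/sumsetP => -[a [b [_]]].
by rewrite in_fset0.
Qed.

Lemma leq_card_imfset2 {S T U : choiceType} (f : S -> T -> U)
    (A : {fset S}) (B : {fset T}) :
  (#|` [fset f a b | a in A, b in B]%fset| <= #|` A| * #|` B|)%N.
Proof.
rewrite -(size_allpairs f); apply: uniq_leq_size; first exact: fset_uniq.
move=> x /imfset2P[a /= aA [b /= bB ->]].
by apply/allpairsP; exists (a, b).
Qed.

Lemma card_translate {R} (A : {fset R}) (c : R) :
  #|` [fset (a + c)%R | a in A]%fset| = #|` A|.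
Proof. by rewrite card_imfset //; apply: addIr. Qed.

(** * Ruzsa's triangle inequality and Petridis' proof of Pluennecke's inequality *)

(** Fix one representation d = y - z for each d in Y - Z. The map (d, x) -> (x + y, x + z) is
    injective: the difference of the two coordinates returns d, hence y, and then x. *)
Lemma ruzsa_triangle {R} (X Y Z : {fset R}) :
  (#|` diffset Y Z| * #|` X| <= #|` sumset X Y| * #|` sumset X Z|)%N.
Proof.
(* [choice] yields a total function, so d outside Y - Z gets the dummy pair (0, 0). *)
have /boolp.choice[g gP] : forall d : R, exists yz : R * R, d \in diffset Y Z ->
    [/\ yz.1 \in Y, yz.2 \in Z & d = yz.1 - yz.2].
  move=> d.
  have [/diffsetP[y [z [yY zZ ->]]]|] := boolP (d \in diffset Y Z).
    by exists (y, z).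
  by exists (0, 0).
pose h d x := (x + (g d).1, x + (g d).2).
rewrite -(size_allpairs h) -(size_allpairs pair); apply: uniq_leq_size.
  apply: allpairs_uniq; rewrite ?fset_uniq // => -[d x] [d' x'] /=.
  move=> /allpairsP[[d1 x1] /= [dD _ [? ?]]] /allpairsP[[d2 x2] /= [d'D _ [? ?]]].
  subst d1 x1 d2 x2; rewrite /h => -[e1 e2].
  have [_ _ dE] := gP _ dD; have [_ _ d'E] := gP _ d'D.
  have ee : d = d'.
    have E (w u v : R) : u - v = (w + u) - (w + v) by rewrite [w + u]addrC addrKA.
    by rewrite dE d'E (E x) e1 e2 -E.
  by rewrite -ee in e1; rewrite -ee (addIr _ e1).
move=> _ /allpairsP[[d x] /= [dD xX ->]]; have [yY zZ _] := gP _ dD.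
by apply/allpairsP; exists (h d x); rewrite !mem_sumset.
Qed.

(** X minimises |X + B|/|X| over the non-empty subsets of A, with the ratios cross-multiplied. If A
    itself is not minimal, some Z has a strictly smaller ratio; strictness makes Z non-empty and
    proper, and the induction continues inside Z. *)
Lemma petridis_min {R} (A B : {fset R}) : A != fset0 ->
  exists X : {fset R}, [/\ X != fset0, (X `<=` A)%fset,
    (#|` sumset X B| * #|` A| <= #|` sumset A B| * #|` X|)%N &
    forall Z : {fset R}, (Z `<=` X)%fset ->
      (#|` sumset X B| * #|` Z| <= #|` sumset Z B| * #|` X|)%N].
Proof.
elim/finSet_rect: A => A IH A0.
have [minA|] := pselect (forall Z : {fset R}, (Z `<=` A)%fset ->
      (#|` sumset A B| * #|` Z| <= #|` sumset Z B| * #|` A|)%N).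
  by exists A; rewrite fsubset_refl.
move=> /existsNP[Z /not_implyP[ZA /negP]]; rewrite -ltnNge => ltZ.
have Z0 : Z != fset0 by apply: contraTneq ltZ => ->; rewrite cardfs0 muln0.
have ZpA : (Z `<` A)%fset.
  rewrite fproperEneq ZA andbT; apply: contraTneq ltZ => ->.
  by rewrite ltnn.
have [X [X0 XZ leXZ minX]] := IH Z ZpA Z0.
exists X; split=> //; first exact: fsubset_trans XZ ZA.
rewrite -cardfs_gt0 in Z0.
rewrite -(leq_pmul2r Z0).
have : (#|` sumset X B| * #|` Z| * #|` A| <= #|` sumset Z B| * #|` X| * #|` A|)%N.
  by rewrite leq_mul2r leXZ orbT.
have : (#|` sumset Z B| * #|` A| * #|` X| <= #|` sumset A B| * #|` Z| * #|` X|)%N.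
  by rewrite leq_mul2r ltnW ?orbT.
nia.
Qed.

(* Induction on C: adding c to C adds to X + C the translates of X \ Z, where
   Z = {x in X : x + c in X + C}, and to X + B + C at most those of
   (X + B) \ (Z + B), since Z + B + c is already in X + B + C. *)
Lemma petridis {R} (X B C : {fset R}) :
  (forall Z : {fset R}, (Z `<=` X)%fset ->
      (#|` sumset X B| * #|` Z| <= #|` sumset Z B| * #|` X|)%N) ->
  (#|` sumset (sumset X B) C| * #|` X| <= #|` sumset X B| * #|` sumset X C|)%N.
Proof.
move=> minX; elim/finSet_rect: C => C IH.
have [->|[c cC]] := fset_0Vmem C; first by rewrite !sumset_empty cardfs0.
have {IH} := IH _ (fproperD1 cC); set C' := (C `\ c)%fset => IH.
have CE : C = (c |` C')%fset by rewrite fsetD1K.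
have C'C : (C' `<=` C)%fset by rewrite CE fsubsetUr.
pose Z := [fset x in X | (x + c)%R \in sumset X C']%fset.
have ZX : (Z `<=` X)%fset by apply/fsubsetP=> x; rewrite !inE => /andP[].
pose T (Y : {fset R}) := [fset (a + c)%R | a in Y]%fset.
have memT (Y : {fset R}) u : (u + c \in T Y) = (u \in Y).
  apply/imfsetP/idP => [[y /= yY /addIr ->]|uY] //.
  by exists u.
have card_new (U V : {fset R}) : (V `<=` U)%fset ->
    #|` T U `\` T V|%fset = (#|` U| - #|` V|)%N.
  move=> /fsubsetP VU; rewrite cardfsDS ?card_translate //.
  by apply/fsubsetP=> _ /imfsetP[v /= vV ->]; rewrite memT VU.
have sXC : #|` sumset X C| = (#|` sumset X C'| + (#|` X| - #|` Z|))%N.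
  rewrite -card_new // -[RHS]subn0 -(cardfs0 R).
  have <- : (sumset X C' `&` (T X `\` T Z) = fset0)%fset.
    apply/fsetP=> y; rewrite !inE; apply/negP.
    case/and3P => yXC nyZ /imfsetP[x /= xX yE].
    by rewrite yE memT !inE /= xX -yE yXC in nyZ.
  rewrite -cardfsU; congr #|` _|; apply/fsetP=> y; rewrite in_fsetU in_fsetD.
  apply/sumsetP/orP => [[x [d [xX]]]|].
    rewrite CE in_fset1U => /orP[/eqP ->|dC'] ->; last by left; rewrite mem_sumset.
    have [|nm] := boolP (x + c \in sumset X C'); [by left|right].
    by rewrite !memT xX !inE /= xX nm.
  case=> [/sumsetP[x [d [xX dC' ->]]]|/andP[_ /imfsetP[x /= xX ->]]].
    by exists x, d; rewrite (fsubsetP C'C).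
  by exists x, c.
have sXBC : (#|` sumset (sumset X B) C| <= #|` sumset (sumset X B) C'| +
      (#|` sumset X B| - #|` sumset Z B|))%N.
  rewrite -card_new ?sumsetS //.
  apply: leq_trans (leq_card_fsetU _ _); apply: fsubset_leq_card.
  apply/fsubsetP=> _ /sumsetP[u [d [uXB dC ->]]]; rewrite in_fsetU in_fsetD.
  move: dC; rewrite CE in_fset1U => /orP[/eqP ->|dC']; last by rewrite mem_sumset.
  rewrite !memT uXB andbT orbC -implybE.
  apply/implyP => /sumsetP[z [b [zZ bB ->]]].
  move: zZ; rewrite !inE /= => /andP[_ /sumsetP[x [d' [xX dC' zE]]]].
  by rewrite addrAC zE addrAC !mem_sumset.
(* Minimality at Z bounds the growth (|X + B| - |Z + B|)|X| by |X + B|(|X| - |Z|), which is |X + B|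
   times the growth of |X + C|. *)
have := minX Z ZX; have := fsubset_leq_card ZX.
have /fsubset_leq_card := sumsetS _ _ _ _ ZX (fsubset_refl B).
move: IH sXBC; rewrite sXC; nia.
Qed.

(** The 2^n-fold sumset of A. *)
Fixpoint iter_sumset {R} (n : nat) (A : {fset R}) : {fset R} :=
  if n is n'.+1 then sumset (iter_sumset n' A) (iter_sumset n' A) else A.

Fixpoint iter_diffset {R} (n : nat) (A : {fset R}) : {fset R} :=
  if n is n'.+1 then diffset (iter_diffset n' A) (iter_diffset n' A) else A.

(** Induction through (a - b) - (c - d) = (a + d) - (b + c): each further difference doubles the
    number of summands on both sides. *)
Lemma iter_diffset_sub {R} (n : nat) (A : {fset R}) :
  (iter_diffset n.+1 A `<=` diffset (iter_sumset n A) (iter_sumset n A))%fset.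
Proof.
elim: n => [|n IH]; first exact: fsubset_refl.
apply: fsubset_trans (diffsetS _ _ _ _ IH IH) _; apply/fsubsetP => x.
move=> /diffsetP[y [z [/diffsetP[a [b [aP bP ->]]] /diffsetP[c [d [cP dP ->]]] ->]]] {x y z}.
by rewrite opprB addrACA -opprD mem_diffset ?mem_sumset.
Qed.

(* Petridis' lemma bounds X + 2^n A; Ruzsa's triangle inequality with common
   summand X then passes to differences. *)
Lemma card_iter_diffset {F R} (A : {fset R}) (K : F) (n : nat) :
  A != fset0 -> 0 <= K -> #|` sumset A A|%:R <= K * #|` A|%:R ->
  #|` iter_diffset n.+1 A|%:R <= K ^+ (2 ^ n.+1) * #|` A|%:R :> F.
Proof.
move=> A0 K0 AA; have [X [X0 XA leX minX]] := petridis_min A A A0.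
have cA : 0 < #|` A|%:R :> F by rewrite ltr0n cardfs_gt0.
have cX : 0 < #|` X|%:R :> F by rewrite ltr0n cardfs_gt0.
have XK : #|` sumset X A|%:R <= K * #|` X|%:R :> F.
  rewrite -(ler_pM2r cA) -natrM; apply: le_trans (_ : (#|` sumset A A| * #|` X|)%:R <= _).
    by rewrite ler_nat.
  by rewrite natrM mulrAC ler_wpM2r ?ler0n.
have XAK C : #|` sumset (sumset X A) C|%:R <= K * #|` sumset X C|%:R :> F.
  rewrite -(ler_pM2r cX) -natrM.
  apply: le_trans (_ : (#|` sumset X A| * #|` sumset X C|)%:R <= _).
    by rewrite ler_nat; apply: petridis.
  by rewrite natrM mulrAC ler_wpM2r ?ler0n.
(* The arbitrary summand C lets the induction hypothesis act twice: X + (M + M) + C is regrouped as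
   (X + M) + (M + C), which removes one copy of M, and then the other. *)
have XnK m C : #|` sumset (sumset X (iter_sumset m A)) C|%:R <=
    K ^+ (2 ^ m) * #|` sumset X C|%:R :> F.
  elim: m C => [|m IH] C; first by rewrite expn0 expr1.
  rewrite /= sumsetA -sumsetA; apply: le_trans (IH _) _.
  rewrite expnS mul2n -addnn exprD -mulrA ler_wpM2l ?exprn_ge0 // sumsetA.
  exact: IH.
have := XnK n [fset 0]%fset; rewrite !sumset0 => XnK0.
apply: le_trans (_ : K ^+ (2 ^ n.+1) * #|` X|%:R <= _); last first.
  by rewrite ler_wpM2l ?exprn_ge0 // ler_nat fsubset_leq_card.
apply: le_trans (_ : #|` diffset (iter_sumset n A) (iter_sumset n A)|%:R <= _).
  by rewrite ler_nat fsubset_leq_card ?iter_diffset_sub.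
rewrite -(ler_pM2r cX) -natrM.
apply: le_trans (_ : (#|` sumset X (iter_sumset n A)| ^ 2)%:R <= _).
  by rewrite ler_nat; apply: ruzsa_triangle.
rewrite natrX -mulrA -expr2 expnSr exprM -exprMn.
by rewrite lerXn2r ?nnegrE ?mulr_ge0 ?exprn_ge0 ?ler0n.
Qed.

(** * Averaging and double counting *)

Lemma fset_avg {F} {T : choiceType} (A : {fset T}) (f : T -> F) (m : F) :
  A != fset0 -> m * #|` A|%:R <= \sum_(t <- A) f t -> exists2 t, t \in A & m <= f t.
Proof.
move=> A0 le_m; apply: contrapT => no.
move: le_m; apply/negP; rewrite -ltNge.
have -> : m * #|` A|%:R = \sum_(t <- A) m by rewrite big_const_seq count_predT iter_addr_0 mulr_natr.
have [t0 t0A] : exists t, t \in A by apply/fset0Pn.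
have ltm t : t \in A -> f t < m.
  by move=> tA; rewrite ltNge; apply/negP => mf; apply: no; exists t.
rewrite !(big_fsetD1 t0 t0A) /= ltr_leD ?ltm //.
by rewrite big_seq [leRHS]big_seq ler_sum // => t /fsetD1P[_ /ltm/ltW].
Qed.

Lemma card_sumb {F} {T : choiceType} (A : {fset T}) (p : pred T) :
  #|` [fset t in A | p t]%fset|%:R = \sum_(t <- A) (p t)%:R :> F.
Proof.
rewrite card_fset_sum1 natr_sum big_fset /= big_mkcond /=.
by apply: eq_bigr => t _; case: (p t).
Qed.

Lemma double_count {F} {S T : choiceType} (A : {fset S}) (B : {fset T})
    (r : S -> T -> bool) (m n : F) :
  (forall a, a \in A -> n <= #|` [fset b in B | r a b]%fset|%:R) ->
  (forall b, b \in B -> #|` [fset a in A | r a b]%fset|%:R <= m) ->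
  n * #|` A|%:R <= m * #|` B|%:R.
Proof.
move=> hA hB.
have cst (U : choiceType) (X : {fset U}) (k : F) : k * #|` X|%:R = \sum_(t <- X) k.
  by rewrite big_const_seq count_predT iter_addr_0 mulr_natr.
rewrite !cst; apply: le_trans (_ : \sum_(a <- A) \sum_(b <- B) (r a b)%:R <= _).
  by rewrite big_seq [leRHS]big_seq ler_sum // => a /hA; rewrite card_sumb.
rewrite exchange_big /=.
by rewrite big_seq [leRHS]big_seq ler_sum // => b /hB; rewrite card_sumb.
Qed.

(** * Cancellation and dilates *)

Lemma rng_mulBr {R} (x y z : R) : (x * (y - z)%R)%g = (x * y)%g - (x * z)%g.
Proof. by apply/eqP; rewrite eq_sym subr_eq -rngMDr subrK. Qed.

Lemma rng_mulBl {R} (x y z : R) : ((x - y)%R * z)%g = (x * z)%g - (y * z)%g.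
Proof. by apply/eqP; rewrite eq_sym subr_eq -rngMDl subrK. Qed.

Lemma nonzerodivisor_injl {R} (r : R) :
  r \in nonzerodivisors R -> injective (fun x : R => r * x)%g.
Proof.
move=> /set_mem rR x y /eqP; rewrite -subr_eq0 -rng_mulBr => rxy.
apply/eqP; rewrite -subr_eq0; apply: contraTT rxy => /rR[].
by [].
Qed.

Lemma nonzerodivisor_injr {R} (r : R) :
  r \in nonzerodivisors R -> injective (fun x : R => x * r)%g.
Proof.
move=> /set_mem rR x y /eqP; rewrite -subr_eq0 -rng_mulBl => rxy.
apply/eqP; rewrite -subr_eq0; apply: contraTT rxy => /rR[].
by [].
Qed.

Definition lscale {R} (a : R) (A : {fset R}) : {fset R} :=
  [fset (a * x)%g | x in A]%fset.

Definition rscale {R} (a : R) (A : {fset R}) : {fset R} :=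
  [fset (x * a)%g | x in A]%fset.

Lemma lscaleP {R} {a : R} {A : {fset R}} {x : R} :
  reflect (exists2 y, y \in A & x = (a * y)%g) (x \in lscale a A).
Proof. exact: imfsetP. Qed.

Lemma rscaleP {R} {a : R} {A : {fset R}} {x : R} :
  reflect (exists2 y, y \in A & x = (y * a)%g) (x \in rscale a A).
Proof. exact: imfsetP. Qed.

Lemma mem_lscale {R} (a : R) {A : {fset R}} {x : R} :
  x \in A -> (a * x)%g \in lscale a A.
Proof. by move=> xA; apply/lscaleP; exists x. Qed.

Lemma mem_rscale {R} (a : R) {A : {fset R}} {x : R} :
  x \in A -> (x * a)%g \in rscale a A.
Proof. by move=> xA; apply/rscaleP; exists x. Qed.

Lemma lscale_diffset {R} (a : R) (A B : {fset R}) :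
  lscale a (diffset A B) = diffset (lscale a A) (lscale a B).
Proof.
apply/fsetP=> x; apply/lscaleP/diffsetP.
  case=> _ /diffsetP[u [v [uA vB ->]]] ->.
  by exists (a * u)%g, (a * v)%g; rewrite rng_mulBr !mem_lscale.
case=> _ [_ [/lscaleP[u uA ->] /lscaleP[v vB ->] ->]].
by exists (u - v); rewrite ?rng_mulBr ?mem_diffset.
Qed.

Lemma rscale_diffset {R} (a : R) (A B : {fset R}) :
  rscale a (diffset A B) = diffset (rscale a A) (rscale a B).
Proof.
apply/fsetP=> x; apply/rscaleP/diffsetP.
  case=> _ /diffsetP[u [v [uA vB ->]]] ->.
  by exists (u * a)%g, (v * a)%g; rewrite rng_mulBl !mem_rscale.
case=> _ [_ [/rscaleP[u uA ->] /rscaleP[v vB ->] ->]].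
by exists (u - v); rewrite ?rng_mulBl ?mem_diffset.
Qed.

Lemma lscale_sumset {R} (a : R) (A B : {fset R}) :
  lscale a (sumset A B) = sumset (lscale a A) (lscale a B).
Proof.
apply/fsetP=> x; apply/lscaleP/sumsetP.
  case=> _ /sumsetP[u [v [uA vB ->]]] ->.
  by exists (a * u)%g, (a * v)%g; rewrite rngMDr !mem_lscale.
case=> _ [_ [/lscaleP[u uA ->] /lscaleP[v vB ->] ->]].
by exists (u + v); rewrite ?rngMDr ?mem_sumset.
Qed.

Lemma rscale_sumset {R} (a : R) (A B : {fset R}) :
  rscale a (sumset A B) = sumset (rscale a A) (rscale a B).
Proof.
apply/fsetP=> x; apply/rscaleP/sumsetP.
  case=> _ /sumsetP[u [v [uA vB ->]]] ->.
  by exists (u * a)%g, (v * a)%g; rewrite rngMDl !mem_rscale.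
case=> _ [_ [/rscaleP[u uA ->] /rscaleP[v vB ->] ->]].
by exists (u + v); rewrite ?rngMDl ?mem_sumset.
Qed.

Lemma lscale_iter_diffset {R} (a : R) (n : nat) (A : {fset R}) :
  lscale a (iter_diffset n A) = iter_diffset n (lscale a A).
Proof. by elim: n => //= n IH; rewrite lscale_diffset IH. Qed.

Lemma rscale_iter_diffset {R} (a : R) (n : nat) (A : {fset R}) :
  rscale a (iter_diffset n A) = iter_diffset n (rscale a A).
Proof. by elim: n => //= n IH; rewrite rscale_diffset IH. Qed.

Lemma iter_diffsetSr {R} (n : nat) (A : {fset R}) :
  iter_diffset n.+1 A = iter_diffset n (diffset A A).
Proof. by elim: n => //= n <-. Qed.

Lemma lscaleS {R} (a : R) (A B : {fset R}) :
  (A `<=` B)%fset -> (lscale a A `<=` lscale a B)%fset.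
Proof.
by move=> /fsubsetP AB; apply/fsubsetP=> _ /lscaleP[x /AB xB ->]; apply: mem_lscale.
Qed.

Lemma rscaleS {R} (a : R) (A B : {fset R}) :
  (A `<=` B)%fset -> (rscale a A `<=` rscale a B)%fset.
Proof.
by move=> /fsubsetP AB; apply/fsubsetP=> _ /rscaleP[x /AB xB ->]; apply: mem_rscale.
Qed.

(** Left and right dilations commute by associativity alone. This is what carries a left factor past
    the right factor c without commutativity. *)
Lemma lrscaleA {R} (a b : R) (A : {fset R}) :
  lscale a (rscale b A) = rscale b (lscale a A).
Proof.
apply/fsetP=> x; apply/lscaleP/rscaleP.
  by case=> _ /rscaleP[y yA ->] ->; exists (a * y)%g; rewrite ?mulgA ?mem_lscale.
by case=> _ /lscaleP[y yA ->] ->; exists (y * b)%g; rewrite ?mulgA ?mem_rscale.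
Qed.

Lemma card_lscale_le {R} (a : R) (A : {fset R}) : (#|` lscale a A| <= #|` A|)%N.
Proof. exact: leq_imfset_card. Qed.

Lemma card_rscale_le {R} (a : R) (A : {fset R}) : (#|` rscale a A| <= #|` A|)%N.
Proof. exact: leq_imfset_card. Qed.

Lemma card_lscale {R} (a : R) (A : {fset R}) :
  a \in nonzerodivisors R -> #|` lscale a A| = #|` A|.
Proof. by move=> /nonzerodivisor_injl aI; rewrite card_imfset. Qed.

Lemma card_rscale {R} (a : R) (A : {fset R}) :
  a \in nonzerodivisors R -> #|` rscale a A| = #|` A|.
Proof. by move=> /nonzerodivisor_injr aI; rewrite card_imfset. Qed.

(** * Covering by few translates *)

(** T is the set of translations. The bound n is a real number so that powers of K can be used
    directly. *)
Definition covered {F R} (n : F) (A S : {fset R}) :=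
  exists2 T : {fset R}, #|` T|%:R <= n & (A `<=` sumset T S)%fset.

Lemma coveredW {F R} {n : F} (A A' S S' : {fset R}) :
  (A' `<=` A)%fset -> (S `<=` S')%fset -> covered n A S -> covered n A' S'.
Proof.
move=> AA SS [T Tn AT]; exists T => //; apply: fsubset_trans AA _.
by apply: fsubset_trans AT _; rewrite sumsetS ?fsubset_refl.
Qed.

Lemma covered_trans {F R} {m n : F} (A B C : {fset R}) :
  covered m A B -> covered n B C -> covered (m * n) A C.
Proof.
move=> [T Tm AT] [U Un BU]; exists (sumset T U).
  apply: le_trans (_ : (#|` T| * #|` U|)%:R <= _).
    by rewrite ler_nat; apply: leq_card_imfset2.
  by rewrite natrM ler_pM ?ler0n.
by apply: fsubset_trans AT _; rewrite -sumsetA sumsetS ?fsubset_refl.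
Qed.

Lemma covered_diffset {F R} {m n : F} (A B C D : {fset R}) :
  covered m A B -> covered n C D -> covered (m * n) (diffset A C) (diffset B D).
Proof.
move=> [T Tm /fsubsetP AT] [U Un /fsubsetP CU]; exists (diffset T U).
  apply: le_trans (_ : (#|` T| * #|` U|)%:R <= _).
    by rewrite ler_nat; apply: leq_card_imfset2.
  by rewrite natrM ler_pM ?ler0n.
apply/fsubsetP=> x /diffsetP[a [c [/AT + /CU + ->]]] {x}.
move=> /sumsetP[t [b [tT bB ->]]] /sumsetP[u [d [uU dD ->]]].
by rewrite opprD addrACA mem_sumset ?mem_diffset.
Qed.

Lemma covered_iter_diffset {F R} {m : F} (n : nat) (A B : {fset R}) :
  covered m A B -> covered (m ^+ (2 ^ n)) (iter_diffset n A) (iter_diffset n B).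
Proof.
move=> AB; elim: n => [|n IH] /=; first by rewrite expn0 expr1.
by rewrite expnS mul2n -addnn exprD; apply: covered_diffset.
Qed.

Lemma covered_lscale {F R} {m : F} (a : R) (A B : {fset R}) :
  covered m A B -> covered m (lscale a A) (lscale a B).
Proof.
move=> [T Tm AT]; exists (lscale a T).
  by apply: le_trans Tm; rewrite ler_nat card_lscale_le.
by rewrite -lscale_sumset lscaleS.
Qed.

Lemma covered_rscale {F R} {m : F} (a : R) (A B : {fset R}) :
  covered m A B -> covered m (rscale a A) (rscale a B).
Proof.
move=> [T Tm AT]; exists (rscale a T).
  by apply: le_trans Tm; rewrite ler_nat card_rscale_le.
by rewrite -rscale_sumset rscaleS.
Qed.

(** T is a maximal subset of A whose translates t + B are disjoint, disjointness being encoded as |T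
    + B| = |T||B|. It is built by adding the elements of A one at a time: if a + B meets some t + B
    then a already lies in t + B - B, and otherwise a joins T. Then |T||B| <= |A + B| <= k|B|. *)
Lemma ruzsa_covering {F R} (k : F) (A B : {fset R}) : B != fset0 ->
  #|` sumset A B|%:R <= k * #|` B|%:R -> covered k A (diffset B B).
Proof.
move=> B0 ABk.
have [T [TA TB AT]] : exists T : {fset R}, [/\ (T `<=` A)%fset,
    #|` sumset T B| = (#|` T| * #|` B|)%N & (A `<=` sumset T (diffset B B))%fset].
  elim/finSet_rect: A {ABk} => A IH.
  have [->|[a aA]] := fset_0Vmem A.
    exists fset0; split; rewrite ?fsub0set // cardfs0 mul0n.
    apply/eqP; rewrite cardfs_eq0; apply/eqP/fsetP=> x; rewrite in_fset0.
    by apply/sumsetP => -[? [?]]; rewrite in_fset0 => -[].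
  have [T [TA TB AT]] := IH _ (fproperD1 aA).
  have AE : A = (a |` (A `\ a))%fset by rewrite fsetD1K.
  have [aT|aT] := boolP (a \in sumset T (diffset B B)).
    exists T; split=> //; first by apply: fsubset_trans TA _; apply: fsubsetDl.
    by rewrite AE fsubUset fsub1set aT.
  exists (a |` T)%fset.
  have TS : (T `<=` a |` T)%fset by rewrite fsubsetUr.
  have B00 : 0 \in diffset B B.
    by have [y yB] := fset0Pn _ B0; rewrite -(subrr y) mem_diffset.
  have aNT : a \notin T by apply: contra aT => aT; rewrite -(addr0 a) mem_sumset.
  split.
  - by rewrite AE fsetUS.
  - rewrite cardfsU1 aNT mulnDl mul1n -TB addnC.
    have -> : sumset (a |` T)%fset B = (sumset T B `|` [fset (b + a)%R | b in B])%fset.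
      apply/fsetP=> x; rewrite in_fsetU; apply/sumsetP/orP.
        case=> u [v []]; rewrite in_fset1U => /orP[/eqP ->|uT] vB ->.
          by right; apply/imfsetP; exists v; rewrite // addrC.
        by left; rewrite mem_sumset.
      case=> [/sumsetP[u [v [uT vB ->]]]|/imfsetP[v /= vB ->]].
        by exists u, v; rewrite in_fset1U uT orbT.
      by exists a, v; rewrite in_fset1U eqxx addrC.
    rewrite cardfsU card_translate (_ : (_ `&` _)%fset = fset0) ?cardfs0 ?subn0 //.
    apply/fsetP=> x; rewrite in_fset0 in_fsetI; apply/negP => /andP[].
    move=> /sumsetP[t [b [tT bB ->]]] /imfsetP[b' /= b'B e].
    have aE : a = t + (b - b') by rewrite addrA e addrC addKr.
    by rewrite aE mem_sumset ?mem_diffset in aT.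
  rewrite AE fsubUset fsub1set -[X in X \in _](addr0 a) mem_sumset ?in_fset1U ?eqxx //.
  by apply: fsubset_trans AT _; rewrite sumsetS ?fsubset_refl.
exists T => //; have cB : 0 < #|` B|%:R :> F by rewrite ltr0n cardfs_gt0.
rewrite -(ler_pM2r cB) -natrM -TB; apply: le_trans ABk.
by rewrite ler_nat fsubset_leq_card ?sumsetS ?fsubset_refl.
Qed.

(** Some translate t + S contains x a for at least |A|/L elements a of A. Subtracting a fixed one of
    them, a0, cancels t, so every d = a - a0 has x d in S - S. *)
Lemma pigeonhole_diffset {F R} (L : F) (x : R) (A S : {fset R}) :
  A != fset0 -> 0 < L -> covered L (lscale x A) S ->
  #|` A|%:R / L <= #|` [fset d in diffset A A | (x * d)%g \in diffset S S]%fset|%:R.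
Proof.
move=> A0 L0 [T TL /fsubsetP AT].
pose r (t a : R) := (x * a)%g - t \in S.
have rA a : a \in A -> exists2 t, t \in T & r t a.
  move=> /(mem_lscale x)/AT/sumsetP[t [s [tT sS e]]].
  by exists t; rewrite // /r e addrC addKr.
have T0 : T != fset0.
  by have [a /rA[t tT _]] := fset0Pn _ A0; apply/fset0Pn; exists t.
have [|t tT] := fset_avg T (fun t => #|` [fset a in A | r t a]%fset|%:R) (#|` A|%:R / L) T0.
  apply: le_trans (_ : #|` A|%:R <= _).
    by rewrite mulrAC ler_pdivrMr // ler_wpM2l ?ler0n.
  rewrite (eq_bigr _ (fun t _ => card_sumb A (r t))) exchange_big /=.
  rewrite card_fset_sum1 natr_sum big_seq [leRHS]big_seq ler_sum // => a.
  move=> /rA[t tT rta]; rewrite (big_fsetD1 t) //= rta lerDl sumr_ge0 //.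
set At := [fset a in A | r t a]%fset => le_At.
have At0 : At != fset0.
  rewrite -cardfs_gt0 -(ltr0n F); apply: lt_le_trans le_At.
  by rewrite divr_gt0 // ltr0n cardfs_gt0.
have [a0 a0At] := fset0Pn _ At0.
apply: le_trans le_At _; rewrite ler_nat -(card_translate At (- a0)).
apply: fsubset_leq_card; apply/fsubsetP=> d /imfsetP[a /= aAt ->].
move: a0At aAt; rewrite !inE /= => /andP[a0A ra0] /andP[aA ra].
rewrite mem_diffset //= rng_mulBr.
have -> : (x * a)%g - (x * a0)%g = ((x * a)%g - t) - ((x * a0)%g - t).
  by rewrite opprB addrA subrK.
exact: mem_diffset.
Qed.

(** * Multiplicative energy and large intersections of dilates *)

Lemma popular_dilate {F R} (A : {fset R}) (K : F) :
  A != fset0 -> 0 < K -> #|` prodset A A|%:R <= K * #|` A|%:R ->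
  exists2 b, b \in A &
    #|` A|%:R ^+ 2 / K <=
      \sum_(u <- A) \sum_(a <- A) \sum_(c <- A) ((b * u)%g == (a * c)%g)%:R.
Proof.
move=> A0 K0 AA; set n : F := #|` A|%:R; set P := prodset A A.
pose r (s : R) : F := \sum_(a <- A) \sum_(c <- A) (s == (a * c)%g)%:R.
have sum_delta (g : R -> F) b u : b \in A -> u \in A ->
    \sum_(s <- P) (s == (b * u)%g)%:R * g s = g (b * u)%g.
  move=> bA uA; have buP : (b * u)%g \in P by apply/prodsetP; exists b, u.
  rewrite (big_fsetD1 _ buP) /= eqxx mul1r big_seq big1 ?addr0 // => s.
  by rewrite in_fsetD1 => /andP[/negPf -> _]; rewrite mul0r.
(* Weighting by the representation count r turns a sum over products into a sum over pairs. Taking g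
   = 1 gives the total n^2, and g = r gives the energy, which is then averaged over b. *)
have sum_r (g : R -> F) :
    \sum_(s <- P) r s * g s = \sum_(b <- A) \sum_(u <- A) g (b * u)%g.
  transitivity (\sum_(b <- A) \sum_(u <- A) \sum_(s <- P) (s == (b * u)%g)%:R * g s).
    under eq_bigr do rewrite mulr_suml.
    rewrite exchange_big /=; apply: eq_bigr => b _.
    under eq_bigr do rewrite mulr_suml.
    by rewrite exchange_big.
  rewrite big_seq [RHS]big_seq; apply: eq_bigr => b bA.
  by rewrite big_seq [RHS]big_seq; apply: eq_bigr => u uA; apply: sum_delta.
have n0 : 0 < n by rewrite ltr0n cardfs_gt0.
have cst (k : F) : \sum_(t <- A) k = k * n.
  by rewrite big_const_seq count_predT iter_addr_0 mulr_natr.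
have sum_r1 : \sum_(s <- P) r s = n ^+ 2.
  under eq_bigr do rewrite -[r _]mulr1.
  by rewrite (sum_r (fun=> 1)) !cst mul1r expr2.
apply: fset_avg => //; rewrite -/n.
rewrite -(sum_r r).
(* Cauchy-Schwarz as a sum of squares: n / K is a lower bound for the mean n^2/|P| of r, and with
   |P| <= K n the remaining terms are at least n^3/K. *)
have -> : \sum_(s <- P) r s * r s = \sum_(s <- P) (r s - n / K) ^+ 2 +
    (n ^+ 2 * (2 * (n / K)) - (n / K) ^+ 2 * #|` P|%:R).
  have -> : (n / K) ^+ 2 * #|` P|%:R = \sum_(s <- P) (n / K) ^+ 2.
    by rewrite big_const_seq count_predT iter_addr_0 mulr_natr.
  rewrite -sum_r1 mulr_suml -sumrB -big_split /=.
  by apply: eq_bigr => s _; ring.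
have : 0 <= \sum_(s <- P) (r s - n / K) ^+ 2.
  by apply: sumr_ge0 => s _; apply: sqr_ge0.
have : (n / K) ^+ 2 * #|` P|%:R <= (n / K) ^+ 2 * (K * n).
  by rewrite ler_wpM2l ?sqr_ge0.
have -> : (n / K) ^+ 2 * (K * n) = n ^+ 2 / K * n by field; rewrite gt_eqF.
have -> : n ^+ 2 * (2 * (n / K)) = 2 * (n ^+ 2 / K * n) by field; rewrite gt_eqF.
lra.
Qed.

(** By injectivity at most one c contributes, so summing out one variable of the energy leaves the
    size of an intersection of dilates. *)
Lemma sum_delta_inj {F} {S T : choiceType} (A : {fset S}) (f : S -> T) (x : T) :
  injective f -> \sum_(c <- A) (x == f c)%:R = (x \in [fset f c | c in A]%fset)%:R :> F.
Proof.
move=> fI; case: imfsetP => [[c /= cA ->]|nx].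
  rewrite (big_fsetD1 c) //= eqxx big_seq big1 ?addr0 // => d.
  by rewrite in_fsetD1 => /andP[/negPf dc _]; rewrite (inj_eq fI) eq_sym dc.
rewrite big_seq big1 // => c cA; case: eqP => // xE.
by case: nx; exists c.
Qed.

(** Ruzsa covering by I = A n B, the intersection: A + I lies in A + A, so |A + I| <= K n <= K m
    |I|. In the applications A is a dilate and n is the size of the original set. *)
Lemma covered_meet {F R} (A B : {fset R}) (K m n : F) :
  0 < n -> 0 < m -> 0 <= K -> #|` sumset A A|%:R <= K * n ->
  n / m <= #|` (A `&` B)%fset|%:R -> covered (K * m) A (diffset B B).
Proof.
move=> n0 m0 K0 AA leI; set I := (A `&` B)%fset in leI.
have I0 : I != fset0.
  by rewrite -cardfs_gt0 -(ltr0n F); apply: lt_le_trans leI; rewrite divr_gt0.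
have IB : (I `<=` B)%fset by apply: fsubsetIr.
apply: coveredW (fsubset_refl A) (diffsetS _ _ _ _ IB IB) _.
apply: ruzsa_covering => //; apply: le_trans (_ : #|` sumset A A|%:R <= _).
  by rewrite ler_nat fsubset_leq_card // sumsetS ?fsubset_refl ?fsubsetIl.
apply: le_trans AA _; rewrite -mulrA ler_wpM2l //.
by rewrite -ler_pdivrMl // mulrC.
Qed.

Lemma card_lscaleI {R} (a : R) (A B : {fset R}) : a \in nonzerodivisors R ->
  #|` (lscale a A `&` B)%fset| = #|` [fset u in A | (a * u)%g \in B]%fset|.
Proof.
move=> aR; rewrite -(card_lscale a [fset u in A | _]%fset) //; congr #|` _|.
apply/fsetP=> x; rewrite in_fsetI; apply/andP/lscaleP.
  by case=> /lscaleP[u uA ->] uB; exists u; rewrite // !inE /= uA.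
by case=> u; rewrite !inE /= => /andP[uA uB] ->; rewrite mem_lscale.
Qed.

(* The inclusions a1 a2 A <= a1 b D_1 <= a1 D_2 c <= b D_3 c of the header. *)
Lemma cover_products {F R} (A : {fset R}) (K : F) (a1 a2 b c : R) :
  (forall a, a \in [:: a1; a2] ->
    covered (2 * K ^+ 2) (lscale a A) (lscale b (diffset A A))) ->
  covered (K ^+ 2) (lscale b A) (rscale c (diffset A A)) ->
  covered (2 ^+ 5 * K ^+ 14) (lscale (a1 * a2)%g A)
    (rscale c (lscale b (iter_diffset 3 A))).
Proof.
move=> cov_a cov_b.
have -> : lscale (a1 * a2)%g A = lscale a1 (lscale a2 A).
  apply/fsetP=> x; apply/lscaleP/lscaleP.
    by case=> u uA ->; exists (a2 * u)%g; rewrite ?mulgA ?mem_lscale.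
  by case=> _ /lscaleP[u uA ->] ->; exists u; rewrite ?mulgA.
(* The three factors are the costs of a2 A by b D_1, of b D_1 by D_2 c, and of a1 D_2 by b D_3.
   Passing to D_n raises a cost to the power 2^n. *)
have -> : 2 ^+ 5 * K ^+ 14 =
    2 * K ^+ 2 * ((K ^+ 2) ^+ (2 ^ 1) * (2 * K ^+ 2) ^+ (2 ^ 2)) by ring.
have cov2 : covered (2 * K ^+ 2) (lscale a2 A) (lscale b (diffset A A)).
  by apply: cov_a; rewrite !inE eqxx orbT.
apply: covered_trans (covered_lscale a1 _ _ cov2) _.
have := covered_iter_diffset 1 _ _ cov_b.
rewrite -lscale_iter_diffset -rscale_iter_diffset -iter_diffsetSr.
move=> /(covered_lscale a1) cov1; apply: covered_trans cov1 _.
rewrite lrscaleA; apply: covered_rscale.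
have cov1 : covered (2 * K ^+ 2) (lscale a1 A) (lscale b (diffset A A)).
  by apply: cov_a; rewrite !inE eqxx.
have := covered_iter_diffset 2 _ _ cov1.
by rewrite -!lscale_iter_diffset -iter_diffsetSr.
Qed.

(** * The dichotomy: few zero divisors force few elements in A'A' - A'A' *)

Theorem lemma1p7 (F : realType) :
  exists C C1 C2 : F, [/\ 0 < C, 0 < C1 & 0 < C2] /\
  forall (R : rngType) (A : {fset R}) (K : F),
    A != fset0 ->
    {subset A <= nonzerodivisors R} ->
    1 <= K ->
    #|` sumset A A|%:R <= K * #|` A|%:R ->
    #|` prodset A A|%:R <= K * #|` A|%:R ->
    (C^-1 * K `^ (- C) * #|` A|%:R
       <= #|` [fset d in diffset A A | d \notin nonzerodivisors R]%fset|%:R)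
    \/
    (exists A' : {fset R},
       [/\ (A' `<=` A)%fset,
           #|` A|%:R / (2 * K) <= #|` A'|%:R :> F &
           #|` diffset (prodset A' A') (prodset A' A')|%:R
             <= C1 * K `^ C2 * #|` A'|%:R]).
Proof.
(* With L = 2^10 K^28 below, 2 L = 2^11 K^28 is at most C K^C for C = 2^11, and the final bound 2 L
   * K^34 * 2 K equals 2^12 K^63. *)
exists (2 ^+ 11), (2 ^+ 12), 63; split; first by rewrite !exprn_gt0 ?ltr0n.
move=> R A K A0 AR K1 AA AM.
set N := #|` [fset d in _ | d \notin _]%fset|.
have K0 : 0 < K by apply: lt_le_trans K1.
have n0 : 0 < #|` A|%:R :> F by rewrite ltr0n cardfs_gt0.
have [?|few] := leP ((2 ^+ 11)^-1 * K `^ (- 2 ^+ 11) * #|` A|%:R) N%:R.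
  by left.
right; have [b bA popb] := popular_dilate A K A0 K0 AM.
(* As b is a non-zero-divisor, I a and J c have the sizes of the intersections of b A with a A and
   with A c. *)
pose I a := [fset u in A | (b * u)%g \in lscale a A]%fset.
pose J c := [fset u in A | (b * u)%g \in rscale c A]%fset.
have cst (k : F) : \sum_(t <- A) k = k * #|` A|%:R.
  by rewrite big_const_seq count_predT iter_addr_0 mulr_natr.
have sumI : #|` A|%:R ^+ 2 / K <= \sum_(a <- A) #|` I a|%:R.
  apply: le_trans popb _; rewrite exchange_big /= big_seq [leRHS]big_seq.
  apply: ler_sum => a aA; rewrite card_sumb; apply: ler_sum => u _.
  by rewrite (sum_delta_inj A (fun c => a * c)%g) //; apply/nonzerodivisor_injl/AR.
have sumJ : #|` A|%:R ^+ 2 / K <= \sum_(c <- A) #|` J c|%:R.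
  apply: le_trans popb _.
  under eq_bigr do rewrite exchange_big /=.
  rewrite exchange_big /= big_seq [leRHS]big_seq.
  apply: ler_sum => c cA; rewrite card_sumb; apply: ler_sum => u _.
  by rewrite (sum_delta_inj A (fun a => a * c)%g) //; apply/nonzerodivisor_injr/AR.
have [c cA Jc] : exists2 c, c \in A & #|` A|%:R / K <= #|` J c|%:R.
  by apply: fset_avg => //; rewrite mulrAC -expr2.
have leK u : u \in A -> #|` sumset (lscale u A) (lscale u A)|%:R <= K * #|` A|%:R.
  by move=> uA; apply: le_trans AA; rewrite -lscale_sumset ler_nat card_lscale_le.
have cov_b : covered (K ^+ 2) (lscale b A) (rscale c (diffset A A)).
  rewrite rscale_diffset expr2; apply: covered_meet (leK b bA) _ => //.
    exact: ltW.
  by rewrite card_lscaleI ?AR.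
pose A' := [fset a in A | #|` A|%:R / (2 * K) <= #|` I a|%:R]%fset.
have A'A : (A' `<=` A)%fset by apply/fsubsetP=> a; rewrite !inE => /andP[].
have cov_a a : a \in A' ->
    covered (2 * K ^+ 2) (lscale a A) (lscale b (diffset A A)).
  rewrite !inE => /andP[/= aA leI]; rewrite lscale_diffset.
  have -> : 2 * K ^+ 2 = K * (2 * K) by ring.
  apply: covered_meet (leK a aA) _ => //; [by rewrite mulr_gt0|exact: ltW|].
  by rewrite fsetIC card_lscaleI ?AR.
(* Each a in A' contributes at most |A| to the sum of the |I a|, and each other a at most |A|/(2K).
   The latter total at most half of |A|^2/K. *)
have cardA' : #|` A|%:R / (2 * K) <= #|` A'|%:R :> F.
  rewrite -(ler_pM2r n0).
  have : \sum_(a <- A) #|` I a|%:R <= \sum_(a <- A)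
      ((#|` A|%:R / (2 * K) <= #|` I a|%:R)%R%:R * #|` A|%:R + #|` A|%:R / (2 * K)) :> F.
    apply: ler_sum => a _; have [_|/ltW] := leP (_ / _) #|` I a|%:R.
      rewrite mul1r ler_wpDr ?ler_nat ?fsubset_leq_card ?divr_ge0 ?mulr_ge0 ?ler0n ?ltW //.
      by apply/fsubsetP=> u; rewrite !inE => /andP[].
    by rewrite mul0r add0r.
  rewrite big_split /= -mulr_suml -card_sumb cst => /(le_trans sumI).
  rewrite -lerBlDr; apply: le_trans; rewrite le_eqVlt; apply/orP; left; apply/eqP.
  by field; rewrite gt_eqF.
exists A'; split=> //.
(* L is the square of the cost 2^5 K^14 of one product, since x in Q is a difference of two
   products. *)
set Q := diffset _ _; pose L : F := 2 ^+ 10 * K ^+ 28.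
have L0 : 0 < L by rewrite mulr_gt0 ?exprn_gt0.
pose S := rscale c (lscale b (iter_diffset 5 A)).
have cardS : #|` S|%:R <= K ^+ 32 * #|` A|%:R :> F.
  apply: le_trans (card_iter_diffset A K 4 A0 (ltW K0) AA).
  by rewrite ler_nat (leq_trans (card_rscale_le _ _)) ?card_lscale_le.
have cardD : #|` diffset A A|%:R <= K ^+ 2 * #|` A|%:R :> F.
  exact: (card_iter_diffset A K 0 A0 (ltW K0) AA).
have covQ x : x \in Q ->
    covered L (lscale x A) (rscale c (lscale b (iter_diffset 4 A))).
  move=> /diffsetP[_ [_ [/prodsetP[a1 [a2 [a1P a2P ->]]] /prodsetP[a3 [a4 [a3P a4P ->]]] ->]]].
  have cov u v : u \in A' -> v \in A' -> covered (2 ^+ 5 * K ^+ 14)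
      (lscale (u * v)%g A) (rscale c (lscale b (iter_diffset 3 A))).
    move=> uA vA; apply: cover_products cov_b => a.
    by rewrite !inE => /orP[] /eqP ->; apply: cov_a.
  have := covered_diffset _ _ _ _ (cov _ _ a1P a2P) (cov _ _ a3P a4P).
  rewrite -rscale_diffset -lscale_diffset.
  have -> : 2 ^+ 5 * K ^+ 14 * (2 ^+ 5 * K ^+ 14) = L by rewrite /L; ring.
  apply: coveredW; last exact: fsubset_refl.
  apply/fsubsetP=> y /lscaleP[u uA ->].
  by rewrite rng_mulBl mem_diffset ?mem_lscale.
set D := [fset d in diffset A A | d \in nonzerodivisors R]%fset.
have many x : x \in Q ->
    #|` A|%:R / (2 * L) <= #|` [fset d in D | (x * d)%g \in S]%fset|%:R.
  move=> /covQ/(pigeonhole_diffset _ _ _ _ A0 L0).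
  rewrite -rscale_diffset -lscale_diffset -/(iter_diffset 5 A) -/S.
  set G := [fset d in diffset A A | _]%fset; set G' := [fset d in D | _]%fset.
  have : (#|` G| <= #|` G'| + N)%N.
    apply: leq_trans (leq_card_fsetU _ _); apply: fsubset_leq_card.
    apply/fsubsetP=> d; rewrite !inE /= => /andP[-> ->].
    by rewrite /= andbT orbN.
  rewrite -(ler_nat F) natrD => GN leG.
  (* The failure of (i) enters here: as K >= 1, zero divisors remove at most half of the |A|/L
     differences found by pigeonhole. *)
  have : N%:R <= #|` A|%:R / (2 * L).
    apply: le_trans (ltW few) _; rewrite mulrC ler_wpM2l ?ler0n //.
    rewrite powRN -invfM lef_pV2 ?posrE ?mulr_gt0 ?exprn_gt0 ?powR_gt0 //.
    rewrite /L mulrA -exprS ler_wpM2l ?exprn_ge0 //.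
    rewrite -powR_mulrn ?(ltW K0) //; apply: ler_powR => //.
    by rewrite -natrX ler_nat.
  have -> : #|` A|%:R / (2 * L) = #|` A|%:R / L - #|` A|%:R / (2 * L).
    by field; rewrite gt_eqF.
  lra.
(* For a non-zero-divisor d the map x -> x d is injective, so each d serves at most |S| elements
   x. *)
have few_x d : d \in D -> #|` [fset x in Q | (x * d)%g \in S]%fset|%:R <= #|` S|%:R :> F.
  rewrite !inE /= => /andP[_ dR].
  rewrite ler_nat -(card_rscale d [fset x in Q | _]%fset) //.
  apply: fsubset_leq_card; apply/fsubsetP=> _ /rscaleP[x /= + ->].
  by rewrite !inE => /andP[].
have DS : #|` D|%:R <= K ^+ 2 * #|` A|%:R :> F.
  apply: le_trans cardD; rewrite ler_nat fsubset_leq_card //.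
  by apply/fsubsetP=> d; rewrite !inE => /andP[].
(* Counting pairs (x, d) gives |Q||A|/(2L) <= |S||D| <= K^34 |A|^2. Cancelling |A|/(2L) and using
   |A| <= 2K|A'| finishes the bound. *)
have := double_count Q _ _ _ _ many few_x.
move=> /le_trans-/(_ _ (ler_pM (ler0n _ _) (ler0n _ _) cardS DS)).
have -> : K ^+ 32 * #|` A|%:R * (K ^+ 2 * #|` A|%:R) =
    #|` A|%:R / (2 * L) * (2 * L * K ^+ 34 * #|` A|%:R).
  by field; rewrite gt_eqF.
rewrite ler_pM2l ?divr_gt0 ?mulr_gt0 // => /le_trans; apply.
have -> : 2 ^+ 12 * K `^ 63 * #|` A'|%:R = 2 * L * K ^+ 34 * (#|` A'|%:R * (2 * K)).
  by rewrite powR_mulrn ?ltW // /L; ring.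
apply: ler_wpM2l; first by rewrite !mulr_ge0 ?exprn_ge0 ?ltW.
by rewrite -ler_pdivrMr ?mulr_gt0.
Qed.
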